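(* Let $A$ be a nonempty set of integers and let $r$ be a positive integer such that $r_A(n) \leq r$ for all $n \in \mathbb{Z}$. Then $A(-x,x) \leq \sqrt{8rx}$ for all $x \geq r$.
   Context: For a set $A$ of integers, $r_A(n)$ denotes the number of pairs $(a,a') \in A \times A$ with $a \leq a'$ and $a + a' = n$. $A(-x,x)$ denotes the number of elements $a \in A$ with $-x \leq a \leq x$. *)

(* Defs.v *)
From mathcomp Require Import all_boot all_order all_algebra.
From mathcomp Require Import all_classical all_reals all_analysis.

Set Implicit Arguments.
Unset Strict Implicit.
Unset Printing Implicit Defensive.

Import Order.TTheory GRing.Theory Num.Theory.

Local Open Scope classical_set_scope.
Local Open Scope ring_scope.

(* r_A(n) = [repr_count R A n] may be infinite for an infinite set [A], so it
   takes its values in [\bar R]: [counting X] is the cardinal of [X], and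
   [+oo] when [X] is infinite. *)
Definition repr_count (R : realType) (A : set int) (n : int) : \bar R :=
  counting [set p : int * int |
    [/\ A p.1, A p.2, p.1 <= p.2 & p.1 + p.2 = n]].

Definition count_between (R : realType) (A : set int) (y x : R) : \bar R :=
  counting [set a : int | A a /\ y <= a%:~R <= x].

(* Main.v *)
Require Import Defs.
From mathcomp Require Import all_boot all_order all_algebra.
From mathcomp Require Import all_classical all_reals all_analysis.
From mathcomp Require Import finmap zify lra.

Import Order.TTheory GRing.Theory Num.Theory.
Local Open Scope classical_set_scope.
Local Open Scope ring_scope.

(** Let k = A(-x,x) and N = floor x.  The k(k+1)/2 pairs a <= a' of elements of
    A in [-N, N] have their sums among the 4N + 1 integers of [-2N, 2N], so
    k(k+1)/2 <= r(4N + 1), i.e. k^2 + k <= 8rN + 2r.  If k >= 2r this gives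
    k^2 <= 8rN <= 8rx, and if k <= 2r then k^2 <= 4r^2 <= 8rx since r <= x. *)

(** By symmetry, twice the count is the sum of [(a <= b) + (b <= a)] over all pairs. Each term is at
    least 1 by totality, and is 2 when [a = b]; repetitions in [s] only help. *)
Lemma leq_count_le_pairs {d : Order.disp_t} {T : orderType d} (s : seq T) :
  (size s ^ 2 + size s <=
   2 * size [seq p <- [seq (a, b) | a <- s, b <- s] | (p.1 <= p.2)%O])%N.
Proof.
pose S := (\sum_(a <- s) \sum_(b <- s) (a <= b)%O)%N.
have -> : size [seq p <- [seq (a, b) | a <- s, b <- s] | (p.1 <= p.2)%O] = S.
  rewrite size_filter -sum1_count big_mkcond big_allpairs /=.
  by apply: eq_bigr => a _; apply: eq_bigr => b _; case: ifP.
have -> : (2 * S = \sum_(a <- s) \sum_(b <- s) ((a <= b)%O + (b <= a)%O))%N.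
  rewrite mul2n -addnn [in X in (_ + X)%N]/S exchange_big -big_split /=.
  by apply: eq_bigr => a _; rewrite -big_split.
have -> : (size s ^ 2 + size s = \sum_(a <- s) (size s + 1))%N.
  by rewrite big_const_seq count_predT iter_addn_0 -mulnn; lia.
rewrite big_seq_cond [leqRHS]big_seq_cond; apply: leq_sum => a.
rewrite andbT => as_.
have -> : (size s + 1 = \sum_(b <- s) 1 + 1)%N by rewrite sum1_size.
(* The extra 1 comes from the diagonal: [a] itself occurs in [s]. *)
apply: (@leq_trans (\sum_(b <- s) 1 + \sum_(b <- s | b == a) 1)%N).
  by rewrite leq_add2l sum1_count -has_count has_pred1.
rewrite [X in (_ + X <= _)%N]big_mkcond -big_split /=.
apply: leq_sum => b _.
by case: (ltgtP a b).
Qed.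

(** Pigeonhole, to be applied with [f] the shifted sum of a pair. *)
Lemma size_le_card_fibers {T : eqType} {J : finType} (f : T -> J) (r : nat)
    (s : seq T) :
  (forall j, size [seq t <- s | f t == j] <= r)%N -> (size s <= #|J| * r)%N.
Proof.
move=> fr; rewrite -sum1_size (partition_big f xpredT) //= -sum_nat_const.
by apply: leq_sum => j _; rewrite sum1_count -size_filter.
Qed.

(** A finite bound excludes the value [+oo] taken on infinite sets. *)
Lemma counting_le_nat {T : choiceType} {R : realType} (X : set T) (n : nat) :
  (counting X <= (n%:R : R)%:E)%E ->
  finite_set X /\ (#|` fset_set X| <= n)%N.
Proof.
rewrite /counting; case: asboolP => // finX.
by rewrite lee_fin ler_nat.
Qed.

Lemma finite_set_int_norm_le (N : nat) : finite_set [set a : int | `|a| <= N%:Z].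
Proof.
apply: (@sub_finite_set _ _
  ((fun i : nat => i%:Z - N%:Z) @` `I_(N.*2.+1))); last first.
  exact/finite_image/finite_II.
move=> a /= aN; exists (absz (a + N%:Z)); lia.
Qed.

Theorem theorem3 (R : realType) (A : set int) (r : nat)
    (A_nonempty : A !=set0) (r_gt0 : (0 < r)%N)
    (repr_le : forall n : int, (repr_count R A n <= (r%:R : R)%:E)%E) :
  forall x : R, r%:R <= x ->
    (count_between A (- x) x <= (Num.sqrt (8 * r%:R * x))%:E)%E.
Proof.
move=> x rx.
have x_ge0 : 0 <= x by rewrite (le_trans _ rx).
pose N := absz (Num.floor x).
have NE : Num.floor x = N%:Z by rewrite /N gez0_abs // floor_ge0.
have Nx : N%:R <= x by have := floor_le x; rewrite NE.
rewrite /count_between; set X := [set a : int | _].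
have XN (a : int) : X a -> `|a| <= N%:Z.
  move=> [_ /andP[xa ax]]; rewrite ler_norml -NE lerNl !floor_ge_int ax andbT.
  by rewrite rmorphN /= lerNl.
have finX : finite_set X by exact: sub_finite_set XN (finite_set_int_norm_le N).
rewrite /counting asboolT // lee_fin.
set s : seq int := fset_set X; have := leq_count_le_pairs s.
have Xs a : (a \in s) -> X a by rewrite in_fset_set // => /set_mem.
set P := [seq p <- _ | _] => kP.
have Pr : (size P <= N.*2.*2.+1 * r)%N.
  (* Adding 2N moves the sums from [-2N, 2N] to [0, 4N], so on [P] the [inord] never falls back to
     its default value. *)
  pose f (p : int * int) : 'I_(N.*2.*2.+1) := inord (absz (p.1 + p.2 + N.*2%:Z)).
  rewrite -[N.*2.*2.+1]card_ord; apply: (size_le_card_fibers f) => j.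
  (* The fiber over [j] is a duplicate-free list of representations of [j - 2N], so its length is at
     most [r]. *)
  have [finj] := counting_le_nat _ _ (repr_le (j%:Z - N.*2%:Z)).
  apply: leq_trans; apply: uniq_leq_size.
    by rewrite !filter_uniq // allpairs_uniq ?fset_uniq // => -[? ?] [? ?].
  move=> [a b]; rewrite !mem_filter /= => /and3P[/eqP fj ab].
  move=> /allpairsP[[a' b'] /= [/Xs Xa /Xs Xb [? ?]]]; subst a' b'.
  rewrite in_fset_set //; apply: mem_set; split=> //=; [exact: Xa.1|exact: Xb.1|].
  have aN := XN _ Xa; have bN := XN _ Xb.
  have := congr1 val fj; rewrite /= inordK /=; lia.
set k := #|`_|.
have kE : size s = k by [].
(* [maxn] joins the cases [k <= 2r] and [k > 2r] in one bound over the naturals; in the second, [k]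
   absorbs the term 2r. *)
have k2 : (k ^ 2 <= maxn (8 * r * N) (4 * r * r))%N.
  move: kP Pr; rewrite kE => kP Pr.
  have [kr|kr] := leqP k (2 * r); first nia.
  rewrite leq_max; apply/orP; left; nia.
rewrite -[leLHS]ger0_norm // -sqrtr_sqr ler_wsqrtr //.
have r0 : 0 <= r%:R :> R by [].
rewrite -natrX.
apply: (@le_trans _ _ ((maxn (8 * r * N) (4 * r * r))%:R)); first by rewrite ler_nat.
by case: leqP => _; rewrite !natrM; nra.
Qed.
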